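(* Let $\phi_{\mathrm{xor}}$ be a conjunction of xor-constraints, let $x$ be a variable and let $(V_a,V_b)$ be an $x$-cut partition of $\phi_{\mathrm{xor}}$. Let $\phi^a = \bigwedge_{D \in V_a} D$, $\phi^b = \bigwedge_{D \in V_b} D$, and let $\tilde{l}_1,\dots,\tilde{l}_k,\hat{l}$ be literals over the variables of $\phi_{\mathrm{xor}}$. Then: (I) If $\phi_{\mathrm{xor}} \land \tilde{l}_1\land\dots\land\tilde{l}_k$ is unsatisfiable, then either (1) $\phi^a \land \tilde{l}_1\land\dots\land\tilde{l}_k$ or $\phi^b \land \tilde{l}_1\land\dots\land\tilde{l}_k$ is unsatisfiable; or (2) for some $p_x\in\{\bot,\top\}$, $\phi^a \land \tilde{l}_1\land\dots\land\tilde{l}_k \models (x\equiv p_x)$ and $\phi^b \land \tilde{l}_1\land\dots\land\tilde{l}_k \models (x\equiv p_x\oplus\top)$. (II) If $\phi_{\mathrm{xor}} \land \tilde{l}_1\land\dots\land\tilde{l}_k$ is satisfiable and $\phi_{\mathrm{xor}} \land \tilde{l}_1\land\dots\land\tilde{l}_k \models \hat{l}$, then either (1) $\phi^a \land \tilde{l}_1\land\dots\land\tilde{l}_k \models \hat{l}$ or $\phi^b \land \tilde{l}_1\land\dots\land\tilde{l}_k \models \hat{l}$; or (2) for some $p_x\in\{\bot,\top\}$, $\phi^a \land \tilde{l}_1\land\dots\land\tilde{l}_k \models (x\equiv p_x)$ and $\phi^b \land \tilde{l}_1\land\dots\land\tilde{l}_k\land(x\equiv p_x) \models \hat{l}$;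 or (3) for some $p_x\in\{\bot,\top\}$, $\phi^b \land \tilde{l}_1\land\dots\land\tilde{l}_k \models (x\equiv p_x)$ and $\phi^a \land \tilde{l}_1\land\dots\land\tilde{l}_k\land(x\equiv p_x) \models \hat{l}$.
   Context: Truth values are $\mathbb{B}=\{\bot,\top\}$. An xor-constraint is an equation $x_1 \oplus \dots \oplus x_k \equiv p$ with Boolean variables $x_i$ and parity $p\in\mathbb{B}$ (duplicate variables cancel in pairs); a truth assignment $\tau$ satisfies it if $\tau(x_1)\oplus\dots\oplus\tau(x_k)=p$. A literal is a variable $y$ or its negation $\neg y$, identified with the xor-constraints $y\equiv\top$ and $y\equiv\bot$ respectively. For a set $V$ of xor-constraints, $\mathrm{vars}(V)$ is the set of variables occurring in them. A variable $x$ of $\phi_{\mathrm{xor}}$ determines an $x$-cut partition $(V_a,V_b)$ of $\phi_{\mathrm{xor}}$: a partition of the set of xor-constraints of $\phi_{\mathrm{xor}}$ into two sets $V_a,V_b$ with $\mathrm{vars}(V_a)\cap\mathrm{vars}(V_b)=\{x\}$. *)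

(* Defs.v *)
From HB Require Import structures.
From mathcomp Require Import all_boot finmap.

Set Implicit Arguments.
Unset Strict Implicit.
Unset Printing Implicit Defensive.

Local Open Scope fset_scope.

(* The constraint x_1 (+) ... (+) x_k == p.  As duplicate variables cancel in
   pairs, the left-hand side is determined by the finite set of the variables
   that remain; that set may be empty. *)
Definition xor_constraint (V : choiceType) : choiceType := ({fset V} * bool)%type.

Definition xor_vars (V : choiceType) (D : xor_constraint V) : {fset V} := D.1.
Definition xor_parity (V : choiceType) (D : xor_constraint V) : bool := D.2.

Definition xor_sat (V : choiceType) (tau : V -> bool) (D : xor_constraint V)
  : bool :=
  \big[addb/false]_(y <- xor_vars D) tau y == xor_parity D.

(* A conjunction of xor-constraints, given as the finite set of its conjuncts:
   conjunction is [`|`]. *)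
Definition xor_formula (V : choiceType) : choiceType := {fset xor_constraint V}.

Definition vars (V : choiceType) (F : xor_formula V) : {fset V} :=
  \bigcup_(D <- F) xor_vars D.

Definition satisfies (V : choiceType) (tau : V -> bool) (F : xor_formula V)
  : Prop :=
  forall D : xor_constraint V, D \in F -> xor_sat tau D.

Definition satisfiable (V : choiceType) (F : xor_formula V) : Prop :=
  exists tau : V -> bool, satisfies tau F.

Definition unsatisfiable (V : choiceType) (F : xor_formula V) : Prop :=
  ~ satisfiable F.

Definition entails (V : choiceType) (F : xor_formula V) (D : xor_constraint V)
  : Prop :=
  forall tau : V -> bool, satisfies tau F -> xor_sat tau D.

(* The constraint y == p. *)
Definition xor_unit (V : choiceType) (y : V) (p : bool) : xor_constraint V :=
  ([fset y], p).

Variant literal (V : choiceType) : Type :=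
  | Pos (y : V)
  | Neg (y : V).

Definition lit_var (V : choiceType) (l : literal V) : V :=
  match l with Pos y => y | Neg y => y end.

Definition lit_xor (V : choiceType) (l : literal V) : xor_constraint V :=
  match l with Pos y => xor_unit y true | Neg y => xor_unit y false end.

Definition lits_formula (V : choiceType) (k : nat) (l : 'I_k -> literal V)
  : xor_formula V :=
  [fset lit_xor (l i) | i : 'I_k].

(* Both blocks are automatically nonempty, since [x] occurs in each. *)
Definition cut_partition (V : choiceType) (x : V) (F Va Vb : xor_formula V)
  : Prop :=
  [/\ Va `|` Vb = F, [disjoint Va & Vb] & vars Va `&` vars Vb = [fset x]].

(* Main.v *)
(* Two models of the blocks that agree on the cut variable [x] can be glued:
   each block keeps its own values, and the literals, being unary, are
   preserved because both models satisfy them.  Every case of the theorem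
   applies this to a suitable pair of models. *)
Require Import Defs.
From mathcomp Require Import all_boot finmap.
From Stdlib Require Import Classical.

Local Open Scope fset_scope.

Section XorFormulas.
Set Implicit Arguments.
Unset Strict Implicit.

Variable V : choiceType.
Implicit Types (F G L : xor_formula V) (D : xor_constraint V).
Implicit Types (t : V -> bool) (y : V) (p : bool).

Lemma xor_sat_unit t y p : xor_sat t (xor_unit y p) = (t y == p).
Proof. by rewrite /xor_sat /xor_unit /= big_seq_fset1. Qed.

Lemma lit_xorE (l : literal V) : exists p, lit_xor l = xor_unit (lit_var l) p.
Proof. by case: l => y; [exists true | exists false]. Qed.

Lemma lits_formula_unit k (l : 'I_k -> literal V) D :
  D \in lits_formula l -> exists y p, D = xor_unit y p.
Proof.
by case/imfsetP => i _ ->; have [p ->] := lit_xorE (l i); exists (lit_var (l i)), p.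
Qed.

Lemma satisfiesU t F G :
  satisfies t (F `|` G) <-> satisfies t F /\ satisfies t G.
Proof.
split=> [sat | [satF satG] D].
  by split=> D DF; apply: sat; rewrite in_fsetU DF ?orbT.
by rewrite in_fsetU => /orP[/satF|/satG].
Qed.

Lemma satisfies_unit t y p : satisfies t [fset xor_unit y p] <-> t y = p.
Proof.
split=> [/(_ _ (fset11 _)) | <- D /fset1P ->]; rewrite xor_sat_unit //.
by move/eqP.
Qed.

Lemma varsP y F :
  reflect (exists2 D, D \in F & y \in xor_vars D) (y \in vars F).
Proof.
rewrite /vars; apply: (iffP (bigfcupP _ _ _ _)) => [[D /andP[DF _] yD] | [D DF yD]]; exists D => //.
by rewrite DF.
Qed.

Lemma varsU F G : vars (F `|` G) = vars F `|` vars G.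
Proof.
apply/fsetP=> y; rewrite in_fsetU; apply/varsP/orP.
  case=> D; rewrite in_fsetU => /orP[DF|DG] yD; [left|right];
  by apply/varsP; exists D.
by case=> /varsP[D DH yD]; exists D => //; rewrite in_fsetU DH ?orbT.
Qed.

Lemma eq_in_satisfies t t' F :
  {in vars F, t =1 t'} -> satisfies t F -> satisfies t' F.
Proof.
move=> tt' sat D DF; rewrite /xor_sat -(eqP (sat D DF)); apply/eqP.
apply: eq_big_seq => y yD; rewrite tt' //; apply/varsP.
by exists D.
Qed.

Section Cut.
Variables (x : V) (F G L : xor_formula V).
Hypothesis cutFG : vars F `&` vars G = [fset x].
Hypothesis unitL : forall D, D \in L -> exists y p, D = xor_unit y p.

(** The second conclusion, agreement with [t] on [vars F], lets a consequence of the whole formula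
    about a variable of [F] be read back on [t]. *)
Lemma glue_models t u :
    satisfies t (F `|` L) -> satisfies u (G `|` L) -> t x = u x ->
  exists2 v, satisfies v (F `|` G `|` L) & {in vars F, v =1 t}.
Proof.
move=> /satisfiesU[tF tL] /satisfiesU[uG uL] tux.
pose v y := if y \in vars F then t y else u y.
have vt : {in vars F, v =1 t} by move=> y yF; rewrite /v yF.
have vu : {in vars G, v =1 u}.
  (* The two definitions of [v] could only clash on a variable of both blocks, which is [x], where
     [t] and [u] agree. *)
  move=> y yG; rewrite /v; case: ifP => // yF.
  have: y \in vars F `&` vars G by rewrite in_fsetI yF.
  by rewrite cutFG => /fset1P->.
exists v => //; apply/satisfiesU; split; first (apply/satisfiesU; split).
- by apply: eq_in_satisfies tF => y /vt.
- by apply: eq_in_satisfies uG => y /vu.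
(* A unit constraint reads [v] at a single variable, so it sees only [t] or only [u], and both
   satisfy it. *)
- move=> D DL; move: (tL D DL) (uL D DL); have [y [p ->]] := unitL DL.
  by rewrite !xor_sat_unit /v; case: ifP.
Qed.

(** Models of the two sides never agree at [x], since they could be glued. As there are only two
    truth values, if both sides have models then [x] is constant on each side, with opposite
    values. *)
Lemma cut_unsatisfiable :
    unsatisfiable (F `|` G `|` L) ->
  (unsatisfiable (F `|` L) \/ unsatisfiable (G `|` L)) \/
  (exists p, entails (F `|` L) (xor_unit x p) /\
             entails (G `|` L) (xor_unit x (p (+) true))).
Proof.
move=> unsat.
have diff t u : satisfies t (F `|` L) -> satisfies u (G `|` L) -> t x != u x.
  move=> tF uG; apply/eqP => tux; apply: unsat.
  by have [v vsat _] := glue_models tF uG tux; exists v.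
have [[t tF]|] := classic (satisfiable (F `|` L)); last by left; left.
have [[u uG]|] := classic (satisfiable (G `|` L)); last by left; right.
right; exists (t x); split=> w wsat; rewrite xor_sat_unit.
  by move: (diff t u tF uG) (diff w u wsat uG); do 3!case: (_ x).
by move: (diff t w tF wsat); do 2!case: (_ x).
Qed.

(** A model of [F] and [L] that violates the literal cannot be glued to any model of [G] and [L], so
    all the latter take the opposite value at [x]. Fixing [x] to that value makes every model on the
    [F] side gluable, hence subject to the entailment. *)
Lemma cut_entails_unit y p :
    y \in vars F -> satisfiable (F `|` G `|` L) ->
    entails (F `|` G `|` L) (xor_unit y p) ->
  entails (F `|` L) (xor_unit y p) \/
  (exists q, entails (G `|` L) (xor_unit x q) /\
             entails (F `|` L `|` [fset xor_unit x q]) (xor_unit y p)).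
Proof.
(* The model [s] is kept as a model of the [G] side: it is the gluing partner in the last step. *)
move=> yF [s /satisfiesU[/satisfiesU[_ sG] sL]] ent.
have {sG sL} sGL : satisfies s (G `|` L) by apply/satisfiesU.
have agree t u : satisfies t (F `|` L) -> satisfies u (G `|` L) ->
    t x = u x -> xor_sat t (xor_unit y p).
  move=> tF uG tux; have [v vsat vt] := glue_models tF uG tux.
  by have := ent v vsat; rewrite !xor_sat_unit vt.
have [|] := classic (entails (F `|` L) (xor_unit y p)); first by left.
move=> /not_all_ex_not[t nt]; right; have [tF nty] := imply_to_and _ _ nt.
have Gx u : satisfies u (G `|` L) -> u x = ~~ t x.
  move=> uG; have : t x != u x by apply/eqP => tux; apply: nty; apply: agree tux.
  by do 2!case: (_ x).
(* The forced value is the negation of the one that the countermodel [t] gives to [x]. *)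
exists (~~ t x); split=> [u /Gx ux | u /satisfiesU[uF /satisfies_unit ux]].
  by rewrite xor_sat_unit ux.
by apply: (agree _ _ uF sGL); rewrite ux (Gx s sGL).
Qed.

End Cut.
End XorFormulas.

Theorem theorem1 (V : choiceType) (phi : xor_formula V) (x : V)
    (Va Vb : xor_formula V) (k : nat) (l : 'I_k -> literal V) (lhat : literal V)
    (cut : cut_partition x phi Va Vb)
    (l_over : forall i : 'I_k, lit_var (l i) \in vars phi)
    (lhat_over : lit_var lhat \in vars phi) :
  (unsatisfiable (phi `|` lits_formula l) ->
     (unsatisfiable (Va `|` lits_formula l) \/
      unsatisfiable (Vb `|` lits_formula l)) \/
     (exists px : bool,
        entails (Va `|` lits_formula l) (xor_unit x px) /\
        entails (Vb `|` lits_formula l) (xor_unit x (px (+) true))))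
  /\
  (satisfiable (phi `|` lits_formula l) ->
   entails (phi `|` lits_formula l) (lit_xor lhat) ->
     (entails (Va `|` lits_formula l) (lit_xor lhat) \/
      entails (Vb `|` lits_formula l) (lit_xor lhat)) \/
     (exists px : bool,
        entails (Va `|` lits_formula l) (xor_unit x px) /\
        entails (Vb `|` lits_formula l `|` [fset xor_unit x px])
          (lit_xor lhat)) \/
     (exists px : bool,
        entails (Vb `|` lits_formula l) (xor_unit x px) /\
        entails (Va `|` lits_formula l `|` [fset xor_unit x px])
          (lit_xor lhat))).
Proof.
case: cut lhat_over => <- _ cutab; rewrite varsU in_fsetU => lhat_ab.
have unitL := @lits_formula_unit V k l.
split; first exact: cut_unsatisfiable.
have [p ->] := lit_xorE lhat; case/orP: lhat_ab => [ya | yb] sat ent.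
  by have [?|?] := cut_entails_unit cutab unitL ya sat ent; [left; left | right; right].
(* When the variable of [lhat] lies in [Vb], the blocks exchange roles, and so do the two
   propagation alternatives. *)
rewrite fsetIC in cutab; rewrite (fsetUC Va) in sat ent.
by have [?|?] := cut_entails_unit cutab unitL yb sat ent; [left; right | right; left].
Qed.
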